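(* Let $l>0$, $\mu>0$ and let $n>\mu$ be an integer with $n\ge 2$. For the Fly-and-Die dynamics with parameters $l,\mu$ and times $t_1\le t_2\le\cdots\le t_n$, the $n$-point velocity auto-correlation function $\rho_v(t_1,\dots,t_n)=\langle v(t_1)v(t_2)\cdots v(t_n)\rangle$ satisfies $$\rho_v(t_1,t_2,\dots,t_n)\sim l\,t_n^{-\mu}\qquad\text{as }t_n\to\infty.$$
   Context: Fly-and-Die dynamics with parameters $l>0$, $\mu>0$: for $x_0\in(0,1]$ let $t_c(x_0)=(l/x_0)^{1/\mu}$. The trajectory starting at $x_0$ is $x(x_0,t)=x_0+t$ for $0\le t\le t_c(x_0)$ and $x(x_0,t)=x_0+t_c(x_0)$ for $t\ge t_c(x_0)$. Its velocity is $v(x_0,t)=1$ while flying ($t<t_c(x_0)$) and $v(x_0,t)=0$ once stopped ($t>t_c(x_0)$). The initial condition $x_0$ is uniformly distributed in $[0,1]$, and $\langle v(t_1)\cdots v(t_n)\rangle=\int_0^1 v(x_0,t_1)\cdots v(x_0,t_n)\,dx_0$. The symbol $A\sim B$ means $A/B\to1$. *)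

(* Defs.v *)
(* MathComp / MathComp-Analysis *)
From HB Require Import structures.
From mathcomp Require Import all_boot all_order all_algebra.
From mathcomp Require Import all_classical all_reals all_analysis.
Set Implicit Arguments.
Unset Strict Implicit.
Unset Printing Implicit Defensive.
Import Order.TTheory GRing.Theory Num.Theory.
Import numFieldNormedType.Exports.
Local Open Scope classical_set_scope.
Local Open Scope ring_scope.

(* t_c(x0) = (l / x0)^(1/mu); meaningful for x0 in (0,1]. *)
Definition fad_stop_time (R : realType) (l mu x0 : R) : R :=
  (l / x0) `^ mu^-1.

Definition fad_position (R : realType) (l mu x0 t : R) : R :=
  if t <= fad_stop_time l mu x0 then x0 + t else x0 + fad_stop_time l mu x0.

(* The velocity is undefined at the instant t = t_c(x0), where the trajectory
   has a corner, so v is only specified away from it: any value is allowed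
   there (as well as for x0 outside (0,1] or t < 0). *)
Definition fad_velocity (R : realType) (l mu : R) (v : R -> R -> R) : Prop :=
  forall x0 t : R, 0 < x0 <= 1 -> 0 <= t ->
    (t < fad_stop_time l mu x0 -> v x0 t = 1) /\
    (fad_stop_time l mu x0 < t -> v x0 t = 0).

(* Average over initial conditions uniformly distributed in [0,1]. *)
Definition mean01 (R : realType) (f : R -> R) : R :=
  Rintegral lebesgue_measure `[0, 1] f.

Definition velocity_correlation (R : realType) (v : R -> R -> R) (n : nat)
    (t : n.-tuple R) : R :=
  mean01 (fun x0 => \prod_(i < n) v x0 (tnth t i)).

(* 0 <= t_1 <= t_2 <= ... <= t_n *)
Definition ordered_times (R : realType) (n : nat) (t : n.-tuple R) : Prop :=
  path <=%R 0 t.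

(* "t_n -> +oo" on the set of ordered n-tuples of times, t_1, ..., t_(n-1) being
   otherwise arbitrary (fixed or varying with t_n): a property holds eventually
   when it holds for all ordered tuples whose last time exceeds some T. *)
Definition last_time_infty (R : realType) (n : nat) : set_system (n.-tuple R) :=
  filter_from [set: R]
    (fun T => [set t : n.-tuple R | ordered_times t /\ T <= last 0 t]).
Arguments last_time_infty : clear implicits.

#[global] Instance last_time_infty_filter (R : realType) (n : nat) :
  Filter (last_time_infty R n).
Proof.
apply: filter_from_filter; first by exists 0.
move=> S T _ _; exists (Num.max S T) => // t [ot].
by rewrite ge_max => /andP[St Tt]; split.
Qed.

Lemma last_time_infty_proper (R : realType) (n : nat) :
  (0 < n)%N -> ProperFilter (last_time_infty R n).
Proof.
case: n => // n _; apply: filter_from_proper => T _.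
exists (nseq_tuple n.+1 (Num.max 0 T)); split.
  rewrite /ordered_times /= le_max lexx /=.
  by elim: n => //= n ->; rewrite lexx.
have -> : last 0 (nseq_tuple n.+1 (Num.max 0 T)) = Num.max 0 T.
  by rewrite /=; elim: n.
by rewrite le_max lexx orbT.
Qed.

(* v is the time derivative of the trajectory wherever the latter has one. *)
Lemma fad_velocityE (R : realType) (l mu : R) (v : R -> R -> R) (x0 t : R) :
  fad_velocity l mu v -> 0 < x0 <= 1 -> 0 < t -> t != fad_stop_time l mu x0 ->
  is_derive t 1 (fad_position l mu x0) (v x0 t).
Proof.
move=> vP x01 t0; have [vfly vstop] := vP x0 t x01 (ltW t0).
rewrite neq_lt => /orP[tc|tc].
  rewrite (vfly tc).
  apply: (@near_eq_is_derive _ _ _ (fun s => x0 + s)).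
    near=> s; rewrite /fad_position ifT //.
    by apply: ltW; near: s; exact: lt_nbhsl.
  by under eq_fun do rewrite addrC; exact: is_derive_shift.
rewrite (vstop tc).
apply: (@near_eq_is_derive _ _ _ (cst (x0 + fad_stop_time l mu x0))).
near=> s; rewrite /fad_position ifF //.
by apply/negbTE; rewrite -ltNge; near: s; exact: lt_nbhsr.
Unshelve. all: by end_near. Qed.

(* Main.v *)
(* Once l <= t_n^mu the asymptotic equality is an identity: the product of the
   velocities is 1 when the last time t_n precedes the stopping time, that is
   when x0 < l t_n^-mu, and 0 when x0 > l t_n^-mu.  The values at x0 = 0 and at
   x0 = l t_n^-mu, where v is unspecified, do not affect the integral. *)
Require Import Defs.
From mathcomp Require Import all_boot all_order all_algebra.
From mathcomp Require Import all_classical all_reals all_analysis.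
From mathcomp Require Import measurable_realfun.
Import Order.TTheory GRing.Theory Num.Theory.
Import numFieldNormedType.Exports.
Local Open Scope classical_set_scope.
Local Open Scope ring_scope.

(** On [[0, 1]] such an [f] is the indicator of []0, a[] corrected at the two points 0 and [a],
    which form a null set. *)
Lemma mean01_step (R : realType) (a : R) (f : R -> R) : 0 < a <= 1 ->
  (forall x, 0 < x < a -> f x = 1) -> (forall x, a < x <= 1 -> f x = 0) ->
  mean01 f = a.
Proof.
move=> /andP[a0 a1] f1 f0.
(* Keeping the arbitrary values [f 0] and [f a] makes [g] equal to [f] at every point of [[0, 1]],
   and [g] is measurable by construction. *)
pose g x := \1_(`]0, a[%classic : set R) x
            + (f 0 * \1_[set 0] x + f a * \1_[set a] x) : R.
have mg : measurable_fun [set: R] g.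
  apply: measurable_funD; first exact: measurable_indic.
  by apply: measurable_funD; apply: measurable_funM => //;
    exact: measurable_indic.
have fg x : x \in `[0, 1]%classic -> f x = g x.
  rewrite inE /= in_itv /= => /andP[x0 x1].
  rewrite /g !indicE !mem_setE !in_set1 in_itv /=.
  have [->|xN0] := eqVneq x 0.
    by rewrite ltxx (lt_eqF a0) /= mulr1 mulr0 addr0 add0r.
  have [->|xNa] := eqVneq x a; first by rewrite ltxx andbF mulr1 mulr0 !add0r.
  have {}x0 : 0 < x by rewrite lt_def xN0.
  rewrite x0 /= !mulr0 !addr0.
  case: (ltgtP x a) xNa => // xa _; first by rewrite f1 ?x0.
  by rewrite f0 ?xa.
have -> : mean01 f = mean01 g by exact: eq_Rintegral.
pose h := \1_(`]0, a[%classic : set R) : R -> R.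
have -> : mean01 g = mean01 h.
  congr fine; apply: ae_eq_integral => //.
  - by apply/measurable_EFinP; exact: measurable_funTS.
  - by apply/measurable_EFinP; exact: measurable_indic.
  (* The exceptional set is finite, hence of Lebesgue measure zero. *)
  - exists [set 0; a]; split.
    + by apply: measurableU; exact: measurable_set1.
    + by apply: countable_lebesgue_measure0; exact: finite_set_countable.
    + move=> x /= /not_implyP[_]; apply: contra_notP => /not_orP[xN0 xNa].
      rewrite /g /h !indicE !in_set1.
      move/eqP/negbTE: xN0 => ->; move/eqP/negbTE: xNa => ->.
      by rewrite !mulr0 !addr0.
rewrite /mean01 /Rintegral [X in fine X](_ : _ = a%:E) //.
apply: etrans; first by apply: integral_indic.
rewrite setIidl; last by apply: subset_itv; rewrite bnd_simp.
by apply: etrans (lebesgue_measure_itv _) _; rewrite /= lte_fin a0 sube0.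
Qed.

Lemma fad_stop_time_powR (R : realType) (l mu x : R) :
  0 < l -> 0 < mu -> 0 < x -> fad_stop_time l mu x `^ mu = l / x.
Proof.
move=> l0 mu0 x0.
by rewrite -powRrM mulVf ?gt_eqF // powRr1 // ltW // divr_gt0.
Qed.

Lemma lt_fad_stop_time (R : realType) (l mu x t : R) :
  0 < l -> 0 < mu -> 0 < x -> 0 < t ->
  (t < fad_stop_time l mu x) = (x < l * t `^ (- mu)).
Proof.
move=> l0 mu0 x0 t0; rewrite powRN ltr_pdivlMr ?powR_gt0 // mulrC.
rewrite -ltr_pdivlMr // -(@fad_stop_time_powR _ l mu) //.
rewrite (leW_mono_in (le_mono_in (gt0_ltr_powR mu0))) //.
all: by rewrite nnegrE ?powR_ge0 ?ltW.
Qed.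

Lemma fad_stop_time_lt (R : realType) (l mu x t : R) :
  0 < l -> 0 < mu -> 0 < x -> 0 < t ->
  (fad_stop_time l mu x < t) = (l * t `^ (- mu) < x).
Proof.
move=> l0 mu0 x0 t0; rewrite powRN ltr_pdivrMr ?powR_gt0 // mulrC.
rewrite -ltr_pdivrMr // -(@fad_stop_time_powR _ l mu) //.
rewrite (leW_mono_in (le_mono_in (gt0_ltr_powR mu0))) //.
all: by rewrite nnegrE ?powR_ge0 ?ltW.
Qed.

Lemma ordered_times_tnth (R : realType) (n : nat) (t : n.-tuple R) (i : 'I_n) :
  ordered_times t -> 0 <= tnth t i <= last 0 t.
Proof.
rewrite /ordered_times le_path_sortedE => /andP[/allP t_ge0 t_sorted].
rewrite t_ge0 ?mem_tnth //= (tnth_nth 0) -nth_last.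
(* The index [i] witnesses that the tuple is nonempty, so [last 0 t] is its entry of index [n.-1]
   and not the default 0. *)
have n_gt0 : (0 < n)%N := leq_ltn_trans (leq0n i) (ltn_ord i).
apply: (sorted_leq_nth le_trans lexx) => //; rewrite ?inE ?size_tuple //.
- by rewrite prednK.
- by rewrite -ltnS prednK.
Qed.

Lemma last_tnth (T : Type) (x0 : T) (n : nat) (t : n.-tuple T)
    (lt_n : (n.-1 < n)%N) : last x0 t = tnth t (Ordinal lt_n).
Proof. by rewrite (tnth_nth x0) -nth_last size_tuple. Qed.

Lemma velocity_correlationE (R : realType) (l mu : R) (v : R -> R -> R)
    (n : nat) (t : n.-tuple R) :
  0 < l -> 0 < mu -> fad_velocity l mu v -> (0 < n)%N -> ordered_times t ->
  0 < last 0 t -> l <= last 0 t `^ mu ->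
  velocity_correlation v t = l * last 0 t `^ (- mu).
Proof.
move=> l0 mu0 vP n0 ot t0 lt.
(* Here [a] is [l * last 0 t]^ (- mu)[; the assumption]l <= last 0 t [^ mu] gives [a <= 1]. *)
apply: mean01_step.
- by rewrite mulr_gt0 ?powR_gt0 //= powRN ler_pdivrMr ?powR_gt0 // mul1r.
- move=> x /andP[x0 xa]; apply: big1 => i _.
  have /andP[ti0 til] := ordered_times_tnth _ _ t i ot.
  have x1 : x <= 1.
    by apply: (le_trans (ltW xa)); rewrite powRN ler_pdivrMr ?powR_gt0 // mul1r.
  have x01 : 0 < x <= 1 by rewrite x0.
  have [vfly _] := vP x (tnth t i) x01 ti0.
  by apply/vfly/(le_lt_trans til); rewrite lt_fad_stop_time.
- move=> x /andP[xa x1].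
  have x0 : 0 < x by apply: lt_trans xa; rewrite mulr_gt0 ?powR_gt0.
  have last_lt : (n.-1 < n)%N by rewrite prednK.
  (* The factor at the last time vanishes, which alone makes the product 0. *)
  rewrite (bigD1 (Ordinal last_lt)) //= -(last_tnth _ 0).
  have x01 : 0 < x <= 1 by rewrite x0.
  have [_ ->] := vP x (last 0 t) x01 (ltW t0).
    by rewrite mul0r.
  by rewrite fad_stop_time_lt.
Qed.

Theorem mainTheorem10 (R : realType) (l mu : R) (n : nat)
    (hl : 0 < l) (hmu : 0 < mu) (hn : (2 <= n)%N) (hmun : mu < n%:R)
    (v : R -> R -> R) (hv : fad_velocity l mu v) :
  velocity_correlation v t / (l * last 0 t `^ (- mu))
    @[t --> last_time_infty R n] --> (1 : R).
Proof.
apply: cvg_near_cst.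
exists (l `^ mu^-1) => // t [ot lt].
have t0 : 0 < last 0 t by apply: lt_le_trans lt; exact: powR_gt0.
rewrite (@velocity_correlationE _ l mu) //.
- by rewrite divff // mulf_neq0 ?gt_eqF ?powR_gt0.
- exact: ltnW.
- have -> : l = (l `^ mu^-1) `^ mu.
    by rewrite -powRrM mulVf ?gt_eqF // powRr1 // ltW.
  by apply: ge0_ler_powR => //; rewrite ?nnegrE ?powR_ge0 ?ltW.
Qed.
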